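(* Let $f\in\mathcal{F}_L(\mathbb{R}_+^N)$, suppose $\nabla f$ is $B$-bounded, let $x(0)\in\mathbb{R}_+^N$, and let the iterates $x(t)$ be generated by $$x(t+1)=\left\lceil x(t)-\frac{\gamma(t)}{\sqrt{N}}\,\mathrm{sign}(\nabla f(x(t)))\right\rceil^+,\qquad t=0,1,2,\ldots,$$ where the step-sizes $\gamma(t)\geq 0$ satisfy $\lim_{t\to\infty}\gamma(t)=0$ and $\sum_{t=0}^\infty\gamma(t)=\infty$. Then $x(t)$ converges to the set of optimal solutions, i.e. $\lim_{t\to\infty}\mathrm{dist}(x(t),\mathcal{X}^\star)=0$.
   Context: $\mathbb{R}_+=[0,\infty)$, $N\geq1$, $L>0$, $B>0$, $\|\cdot\|$ is the Euclidean norm, and $\mathrm{dist}(x,\mathcal{Y})=\inf_{v\in\mathcal{Y}}\|v-x\|$. $\lceil\cdot\rceil^+$ denotes the (componentwise) projection onto $\mathbb{R}_+^N$, i.e. $(\lceil x\rceil^+)_i=\max\{x_i,0\}$. $\mathrm{sign}$ acts componentwise with values in $\{-1,1\}$: $\mathrm{sign}(z)=1$ if $z>0$, $\mathrm{sign}(z)=-1$ if $z<0$, and $\mathrm{sign}(0)\in\{-1,1\}$ is an arbitrary fixed value. Class $\mathcal{F}_L(\mathbb{R}_+^N)$: $f\in\mathcal{F}_L(\mathbb{R}_+^N)$ means $f:\mathbb{R}^N\to\mathbb{R}$ is convex and differentiable with $L$-Lipschitz continuous gradient, and the solution set $\mathcal{X}^\star$ of the problem of minimizing $f(x)$ subject to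 $x\in\mathbb{R}_+^N$ is nonempty and bounded. $\nabla f$ is $B$-bounded if $\|\nabla f(x)\|\leq B$ for all $x\in\mathbb{R}_+^N$. *)

(* Defs.v *)
From mathcomp Require Import all_boot all_order all_algebra.
From mathcomp Require Import all_classical all_reals all_analysis.

Set Implicit Arguments.
Unset Strict Implicit.
Unset Printing Implicit Defensive.

Import Order.TTheory GRing.Theory Num.Theory.
Import numFieldNormedType.Exports.

Local Open Scope classical_set_scope.
Local Open Scope ring_scope.

(* The canonical norm `|x| on 'rV[R]_N is the sup norm; every quantitative
   notion below uses the Euclidean norm instead. The two norms induce the same
   topology, so [differentiable] and ['D_] keep their usual meaning. *)
Definition enorm (R : realType) (N : nat) (x : 'rV[R]_N) : R :=
  Num.sqrt (\sum_(i < N) x ord0 i ^+ 2).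

Definition orthant (R : realType) (N : nat) : set 'rV[R]_N :=
  [set x | forall i, 0 <= x ord0 i].

Definition proj_orthant (R : realType) (N : nat) (x : 'rV[R]_N) : 'rV[R]_N :=
  \row_i Num.max (x ord0 i) 0.

(* [s0] is the value of the sign at 0; unlike for [Num.sg], it is meant to be
   1 or -1. *)
Definition sign (R : realType) (s0 z : R) : R :=
  if 0 < z then 1 else if z < 0 then -1 else s0.

Definition signv (R : realType) (s0 : R) (N : nat) (x : 'rV[R]_N) : 'rV[R]_N :=
  \row_i sign s0 (x ord0 i).

Definition grad (R : realType) (N : nat) (f : 'rV[R]_N -> R) (x : 'rV[R]_N) :
    'rV[R]_N :=
  \row_i 'D_(delta_mx ord0 i) f x.

(* Real-valued [inf], so this is the distance only for nonempty [Y]. *)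
Definition dist_set (R : realType) (N : nat) (x : 'rV[R]_N)
    (Y : set 'rV[R]_N) : R :=
  inf [set enorm (v - x) | v in Y].

Definition orthant_minimizers (R : realType) (N : nat) (f : 'rV[R]_N -> R) :
    set 'rV[R]_N :=
  [set x | orthant x /\ forall y, orthant y -> f x <= f y].

Record F_class (R : realType) (N : nat) (L : R) (f : 'rV[R]_N -> R) : Prop :=
  { F_convex :
      convex_function [set: convex_lmodType 'rV[R]_N] (f : 'rV[R]_N -> R^o);
    F_differentiable : forall x, differentiable f x;
    F_grad_lipschitz :
      forall x y, enorm (grad f x - grad f y) <= L * enorm (x - y);
    F_minimizers_nonempty : orthant_minimizers f !=set0;
    F_minimizers_bounded :
      exists M : R, forall x, orthant_minimizers f x -> enorm x <= M }.

Definition grad_bounded (R : realType) (N : nat) (B : R) (f : 'rV[R]_N -> R) :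
    Prop :=
  forall x, orthant x -> enorm (grad f x) <= B.

(* Main.v *)
Require Import Defs.
From mathcomp Require Import all_boot all_order all_algebra.
From mathcomp Require Import all_classical all_reals all_analysis.
From mathcomp Require Import ring lra.
Import Order.TTheory GRing.Theory Num.Theory.
Import numFieldNormedType.Exports.
Local Open Scope classical_set_scope.
Local Open Scope ring_scope.

(** Sign descent is steepest descent for the sup norm, so the argument measures
    progress by a quantity adapted to that geometry. Put [g = grad f x] and
    [phi x = \sum_i (g_i^+ * min (1, x_i) + g_i^-)], called [kkt_residual] below:
    on the orthant it is nonnegative, and it vanishes exactly when the
    optimality conditions [g_i >= 0], [g_i * x_i = 0] hold.

    - One step of length [a = gamma / sqrt N <= 1] moves coordinate [i] by at
      least [a * min (1, x_i)] in a descent direction when [g_i > 0], and by [a]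
      when [g_i < 0]. Hence [f] decreases by [a * phi x] up to a second-order
      term [L * N^2 * a^2] ([sign_descent]).
    - Convexity gives [f x - f z <= phi x * (1 + 2 `|z| + `|x - z|)] for a
      minimizer [z] ([gap_le_kkt_residual]). A convex function with bounded
      minimizer set grows at least linearly away from it ([F_class_growth]), so
      that the factor that grows with [x] is harmless: [phi] is bounded below by
      a positive constant wherever [f x - f z >= e], although that region need
      not be compact ([kkt_residual_lower_bound]).
    - Since the steps [a] tend to [0] and have an infinite sum, the two facts
      force [f (x t)] to the minimum ([drift_eventually_small]): above level
      [e] the values drop by a fixed multiple of [a], which cannot last, and
      below it the second-order term is too small to escape.
    - Linear growth then confines the tail of the sequence to a ball, and on the
      compact part of this ball that stays away from the minimizers, [f] exceeds
      its minimum by a fixed amount ([minimizer_gap]); so the tail leaves it. *)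

(** * Comparison of the Euclidean and sup norms *)

Lemma enorm_ge0 {R : realType} {N : nat} (x : 'rV[R]_N) : 0 <= enorm x.
Proof. exact: sqrtr_ge0. Qed.

Lemma coord_le_enorm {R : realType} {N : nat} (x : 'rV[R]_N) i :
  `|x ord0 i| <= enorm x.
Proof.
rewrite -sqrtr_sqr ler_wsqrtr// (bigD1 i)//= lerDl.
by apply: sumr_ge0 => j _; exact: sqr_ge0.
Qed.

Lemma enorm_le_sum {R : realType} {N : nat} (x : 'rV[R]_N) :
  enorm x <= \sum_i `|x ord0 i|.
Proof.
have S0 : 0 <= \sum_i `|x ord0 i| by apply: sumr_ge0.
rewrite -[leRHS]ger0_norm// -sqrtr_sqr ler_wsqrtr// expr2 mulr_suml.
apply: ler_sum => i _; rewrite -real_normK ?num_real// expr2.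
rewrite ler_wpM2l// (bigD1 i)//= lerDl.
by apply: sumr_ge0.
Qed.

Lemma coord_le_norm {R : realType} {N : nat} (x : 'rV[R]_N) i :
  `|x ord0 i| <= `|x|.
Proof.
rewrite [leRHS]/Num.Def.normr /= mx_normrE.
by apply/bigmax_geP; right => /=; exists (ord0, i).
Qed.

Lemma norm_le_coord {R : realType} {N : nat} (x : 'rV[R]_N) (r : R) :
  0 <= r -> (forall i, `|x ord0 i| <= r) -> `|x| <= r.
Proof.
move=> r0 xr; rewrite [leLHS]/Num.Def.normr /= mx_normrE.
by apply/bigmax_leP; split => //= -[i j] _ /=; rewrite (ord1 i).
Qed.

Lemma norm_le_enorm {R : realType} {N : nat} (x : 'rV[R]_N) : `|x| <= enorm x.
Proof. by apply: norm_le_coord; [exact: enorm_ge0|exact: coord_le_enorm]. Qed.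

Lemma enorm_le_norm {R : realType} {N : nat} (x : 'rV[R]_N) :
  enorm x <= N%:R * `|x|.
Proof.
apply: le_trans (enorm_le_sum x) _.
apply: (@le_trans _ _ (\sum_(i < N) `|x|)).
  by apply: ler_sum => i _; exact: coord_le_norm.
by rewrite sumr_const card_ord mulr_natl.
Qed.

(** * First-order convexity *)

Lemma F_class_convexity {R : realType} {N : nat} {L : R} {f : 'rV[R]_N -> R}
    (fF : F_class L f) (x y : 'rV[R]_N) (t : R) :
  0 <= t <= 1 -> f (x + t *: (y - x)) <= f x + t * (f y - f x).
Proof.
case/andP=> t0 t1.
have := F_convex fF (Itv01 t0 t1) (x := y) (y := x).
rewrite !inE => /(_ Logic.I Logic.I).
rewrite convRE /= /unstable.onem.
have -> : conv (Itv01 t0 t1) (y : convex_lmodType 'rV[R]_N) x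
   = x + t *: (y - x).
  rewrite /conv /= /unstable.onem/= scalerBl scale1r scalerBr.
  by rewrite addrCA.
by move=> h; lra.
Qed.

Lemma derive_grad {R : realType} {N : nat} {f : 'rV[R]_N -> R} {x : 'rV[R]_N}
    (v : 'rV[R]_N) :
  differentiable f x -> 'D_v f x = \sum_i grad f x ord0 i * v ord0 i.
Proof.
move=> fx; rewrite deriveE// {1}(row_sum_delta v) linear_sum.
apply: eq_bigr => i _; rewrite linearZ mxE deriveE//=.
by rewrite mulrC.
Qed.

(** The difference quotients of [f] along the segment from [x] to [y] are at most
    [f y - f x]; the inequality passes to the limit. *)
Lemma F_class_first_order {R : realType} {N : nat} {L : R} {f : 'rV[R]_N -> R}
    (fF : F_class L f) (x y : 'rV[R]_N) :
  f x + \sum_i grad f x ord0 i * (y ord0 i - x ord0 i) <= f y.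
Proof.
have fx := F_differentiable fF x.
have -> : \sum_i grad f x ord0 i * (y ord0 i - x ord0 i) = 'D_(y - x) f x.
  by rewrite derive_grad//; apply: eq_bigr => i _; rewrite !mxE.
rewrite -lerBrDl.
have /cvg_dnbhs_at_right dx := @diff_derivable _ _ _ f x (y - x) fx.
apply: (cvgr_to_le dx).
near=> h.
have h0 : 0 < h by near: h; exact: nbhs_right_gt.
have h1 : h <= 1 by near: h; exact: nbhs_right_le.
rewrite /= [h *: _ + x]addrC [_ *: _]mulrC ler_pdivrMr//.
rewrite lerBlDl (mulrC _ h) (F_class_convexity fF)//.
by rewrite ltW.
Unshelve. all: by end_near. Qed.

(** * Descent along the sign of the gradient *)

(** The cap at [1] in [min (1, x_i)] makes this a bound on the first-order
    decrease per unit of step: a coordinate with positive slope moves by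
    [min (a, x_i)], which is at least [a * min (1, x_i)] for [a <= 1]. *)
Definition kkt_residual {R : realType} {N : nat} (g x : 'rV[R]_N) : R :=
  \sum_i (if 0 <= g ord0 i then g ord0 i * Num.min 1 (x ord0 i)
          else - g ord0 i).

Lemma kkt_residual_ge0 {R : realType} {N : nat} (g x : 'rV[R]_N) :
  orthant x -> 0 <= kkt_residual g x.
Proof.
move=> x0; apply: sumr_ge0 => i _; case: ifPn => [g0|].
  by rewrite mulr_ge0// le_min ler01 x0.
by rewrite -ltNge oppr_ge0 => /ltW.
Qed.

(** By convexity [f x - f z] is at most [\sum_i g_i * (x_i - z_i)]. A term with
    [g_i >= 0] is at most [g_i * x_i], and [x_i <= min (1, x_i) * (1 + x_i)];
    a term with [g_i < 0] is at most [- g_i * z_i]. *)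
Lemma gap_le_kkt_residual {R : realType} {N : nat} {L : R}
    {f : 'rV[R]_N -> R} (fF : F_class L f) (z x : 'rV[R]_N) :
  orthant z -> orthant x ->
  f x - f z <= kkt_residual (grad f x) x * (1 + 2 * `|z| + `|x - z|).
Proof.
move=> z0 x0; have := F_class_first_order fF x z.
suff : - \sum_i grad f x ord0 i * (z ord0 i - x ord0 i) <=
       kkt_residual (grad f x) x * (1 + 2 * `|z| + `|x - z|) by lra.
rewrite /kkt_residual mulr_suml -sumrN; apply: ler_sum => i _.
have := le_trans (ler_norm _) (coord_le_norm (x - z) i).
have -> : (x - z) ord0 i = x ord0 i - z ord0 i by rewrite !mxE.
have := le_trans (ler_norm _) (coord_le_norm z i).
have := z0 i; have := x0 i.
have := normr_ge0 z; have := normr_ge0 (x - z).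
set D := `|x - z|; set Z := `|z|; move=> D0 Z0 xi0 zi0 zZ xzD.
case: ifPn => [g0|]; last by rewrite -ltNge => g0; nra.
rewrite -mulrN opprB -mulrA ler_wpM2l// minEle.
by case: ifPn; rewrite -?ltNge => x1; nra.
Qed.

(** The first-order inequality is used at the new point [y] and the gradient is
    then compared with the one at [x]. This replaces the integration along the
    segment of the usual descent lemma, at the price of a larger constant in the
    second-order term, where only the order in [a] matters. *)
Lemma sign_descent {R : realType} {N : nat} {L s0 : R} {f : 'rV[R]_N -> R}
    (fF : F_class L f) (s0_sign : s0 = 1 \/ s0 = -1) (x y : 'rV[R]_N) (a : R) :
  0 <= L -> orthant x -> 0 <= a <= 1 ->
  y = proj_orthant (x - a *: signv s0 (grad f x)) ->
  f y <= f x - a * kkt_residual (grad f x) x + L * N%:R ^+ 2 * a ^+ 2.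
Proof.
move=> L0 x0 /andP[a0 a1] y_step.
have dE i : (y - x) ord0 i =
    Num.max (x ord0 i - a * sign s0 (grad f x ord0 i)) 0 - x ord0 i.
  by rewrite y_step !mxE.
have d_le i : `|(y - x) ord0 i| <= a.
  have : -1 <= sign s0 (grad f x ord0 i) <= 1.
    by rewrite /sign; case: s0_sign => ->; do 2?case: ifP => _; lra.
  move=> /andP[s_ge s_le]; rewrite dE; have := x0 i; set s := sign _ _ in s_ge s_le *.
  rewrite ler_norml maxEle; case: ifPn; rewrite -?ltNge => ? ?.
    by apply/andP; split; nra.
  by apply/andP; split; nra.
(* Each coordinate moves against its slope, unless the orthant blocks it. *)
have dg i : grad f x ord0 i * (y - x) ord0 i <=
    - a * (if 0 <= grad f x ord0 i then
             grad f x ord0 i * Num.min 1 (x ord0 i) else - grad f x ord0 i).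
  rewrite dE /sign; have := x0 i; set g := grad f x ord0 i.
  have [g0|g0|->] := ltrgtP g 0; last by rewrite !mul0r mulr0.
  - rewrite maxEle; case: ifPn; rewrite -?ltNge; move=> *; nra.
  - rewrite mulNr [a * (g * _)]mulrCA -[- (g * _)]mulrN => xi0.
    apply: (ler_wpM2l (ltW g0)); rewrite maxEle minEle.
    by do 2?[case: ifPn; rewrite -?ltNge => ?]; move=> *; nra.
have N0 : 0 <= N%:R :> R by [].
have dN : enorm (y - x) <= N%:R * a.
  apply: le_trans (enorm_le_norm _) _; rewrite ler_wpM2l//.
  exact: norm_le_coord.
have gg i : (grad f y ord0 i - grad f x ord0 i) * (y - x) ord0 i <=
    L * N%:R * a ^+ 2.
  have gi := coord_le_enorm (grad f y - grad f x) i.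
  have ly := F_grad_lipschitz fF y x.
  have <- : (grad f y - grad f x) ord0 i = grad f y ord0 i - grad f x ord0 i.
    by rewrite mxE [X in _ + X]mxE.
  apply: le_trans (ler_norm _) _; rewrite normrM.
  have -> : L * N%:R * a ^+ 2 = (L * (N%:R * a)) * a by ring.
  apply: ler_pM => //.
  by apply: le_trans gi (le_trans ly _); rewrite ler_wpM2l.
have := F_class_first_order fF y x.
suff : - \sum_i grad f y ord0 i * (x ord0 i - y ord0 i) <=
   - (a * kkt_residual (grad f x) x) + L * N%:R ^+ 2 * a ^+ 2 by lra.
have -> : L * N%:R ^+ 2 * a ^+ 2 = \sum_(i < N) (L * N%:R * a ^+ 2).
  by rewrite sumr_const card_ord -[RHS]mulr_natr; ring.
rewrite /kkt_residual -mulNr mulr_sumr -big_split -sumrN/=.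
apply: ler_sum => i _; have := dg i; have := gg i.
have -> : (y - x) ord0 i = y ord0 i - x ord0 i by rewrite mxE [X in _ + X]mxE.
set P := - a * _; lra.
Qed.

(** * Growth of the objective away from the minimizers *)

Lemma closed_orthant {R : realType} {N : nat} : closed (@orthant R N).
Proof.
rewrite (_ : orthant (N := N) =
    \bigcap_(i in [set: 'I_N]) [set x : 'rV[R]_N | 0 <= x ord0 i]); last first.
  by apply/seteqP; split=> [x x0 i _|x x0 i]; [exact: x0|exact: (x0 i Logic.I)].
apply: closed_bigI => i _.
apply: (@preimage_closed _ _ (fun x : 'rV[R]_N => x ord0 i) [set u | 0 <= u]).
  by move=> x _; exact: coord_continuous.
exact: closed_ge.
Qed.

(** By compactness. Two choices of [V] matter: a single minimizer with [e = r]
    makes [K] a sphere, and the set of all minimizers makes [K] the part of a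
    ball at distance at least [e] from them. *)
Lemma minimizer_gap {R : realType} {N : nat} {L : R} {f : 'rV[R]_N -> R}
    (fF : F_class L f) (z : 'rV[R]_N) (V : set 'rV[R]_N) (r e : R) :
  orthant_minimizers f z ->
  let K := [set y | [/\ orthant y, `|y - z| <= r &
                        forall v, V v -> e <= `|y - v|]] in
  K `&` orthant_minimizers f = set0 ->
  exists2 m, 0 < m & forall y, K y -> m <= f y - f z.
Proof.
move=> z_min K Kmin.
have fK y : K y -> f z < f y.
  move=> Ky; rewrite ltNge; apply/negP => fyz.
  have : (K `&` orthant_minimizers f) y; last by rewrite Kmin.
  split => //; split; first by case: Ky.
  by move=> w w0; apply: le_trans fyz _; apply: z_min.2.
have dist_cont (v : 'rV[R]_N) : continuous (fun y : 'rV[R]_N => `|y - v|).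
  by move=> y; exact: (cvg_norm (cvgB cvg_id (cvg_cst v))).
have Kcl : closed K.
  rewrite (_ : K = @orthant R N `&` ([set y | `|y - z| <= r] `&`
      \bigcap_(v in V) [set y | e <= `|y - v|])); last first.
    apply/seteqP; split=> y.
      by move=> [y0 yr yV]; split => //; split.
    by move=> [y0 [yr yV]]; split.
  apply: closedI; first exact: closed_orthant.
  apply: closedI.
    apply: (@preimage_closed _ _ (fun y : 'rV[R]_N => `|y - z|) [set u | u <= r]).
      by move=> y _; exact: dist_cont.
    exact: closed_le.
  apply: closed_bigI => v _.
  apply: (@preimage_closed _ _ (fun y : 'rV[R]_N => `|y - v|) [set u | e <= u]).
    by move=> y _; exact: dist_cont.
  exact: closed_ge.
have Kbd : bounded_set K.
  exists (`|z| + r); split; first exact: num_real.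
  move=> M rM y [_ yr _] /=; apply: le_trans (ltW rM).
  by rewrite -(subrK z y) addrC (le_trans (ler_normD _ _))// lerD2l.
have [K0|K0] := eqVneq K set0.
  by exists 1 => // y; rewrite K0.
have fcont : {within K, continuous f}.
  apply: continuous_subspaceT => y.
  exact: (differentiable_continuous (F_differentiable fF y)).
have /set0P Kn := K0.
have [c cK cmin] := EVT_min_rV Kn (bounded_closed_compact Kbd Kcl) fcont.
exists (f c - f z); first by rewrite subr_gt0 fK// -inE.
by move=> y Ky; rewrite lerD2r cmin// inE.
Qed.

(** On a sphere about [z] that encloses all minimizers, [f] exceeds its minimum
    by some [m > 0]; convexity along the rays from [z] propagates this as linear
    growth outside the sphere. *)
Lemma F_class_growth {R : realType} {N : nat} {L : R} {f : 'rV[R]_N -> R}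
    (fF : F_class L f) (z : 'rV[R]_N) (k : R) :
  orthant_minimizers f z -> 0 <= k ->
  exists r c : R, [/\ 0 < r, 0 < c & forall x, orthant x -> r <= `|x - z| ->
    c * (k + `|x - z|) <= f x - f z].
Proof.
move=> z_min k0.
have [M Mb] := F_minimizers_bounded fF.
have Mnorm v : orthant_minimizers f v -> `|v| <= M.
  by move=> /Mb; exact: le_trans (norm_le_enorm _).
have M0 : 0 <= M := le_trans (normr_ge0 z) (Mnorm z z_min).
(* The minimizers and z lie in the ball of radius M about 0, hence none is at
   distance 2 M + 1 from z. *)
pose r := 2 * M + 1.
have r0 : 0 < r by rewrite /r; lra.
have [|m m0 mP] := @minimizer_gap _ _ _ _ fF z [set z] r r z_min.
  rewrite -subset0 => v [[_ _ /(_ z erefl) rv] /Mnorm vM].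
  have := ler_normB v z; have := Mnorm z z_min.
  by rewrite /r in rv *; lra.
exists r, (m / (k + r)); split => //; first by rewrite divr_gt0// ltr_wpDl.
move=> x x0 rx; set rho := `|x - z| in rx *.
have rho0 : 0 < rho := lt_le_trans r0 rx.
have t01 : 0 <= r / rho <= 1.
  by rewrite divr_ge0 ?(ltW r0) ?(ltW rho0)//= ler_pdivrMr// mul1r.
pose y := z + (r / rho) *: (x - z).
have yz : `|y - z| = r.
  rewrite /y addrAC subrr add0r normrZ -/rho ger0_norm ?divfK ?gt_eqF//.
  by case/andP: t01.
have y0 : orthant y.
  case/andP: t01 => t0 t1 i; rewrite !mxE.
  by have := x0 i; have := z_min.1 i; nra.
have my : m <= f y - f z.
  apply: mP; split => //; first by rewrite yz.
  by move=> _ ->; rewrite yz.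
have := F_class_convexity fF z x _ t01; rewrite -/y => fy.
have mr : m <= r / rho * (f x - f z) by lra.
have kr : 0 < k + r by lra.
have rm : rho * m <= r * (f x - f z).
  by rewrite mulrC -ler_pdivlMr// mulrAC.
have mG : m <= f x - f z by rewrite -(ler_pM2l r0); nra.
by rewrite mulrAC ler_pdivrMr//; nra.
Qed.

(** [f x - f z] is at most the residual times [k + `|x - z|]. Inside a ball this
    factor is bounded; outside, [f x - f z] is at least a fixed multiple of it
    by [F_class_growth]. *)
Lemma kkt_residual_lower_bound {R : realType} {N : nat} {L : R}
    {f : 'rV[R]_N -> R} (fF : F_class L f) (z : 'rV[R]_N) (e : R) :
  orthant_minimizers f z -> 0 < e ->
  exists2 d, 0 < d & forall x, orthant x -> e <= f x - f z ->
    d <= kkt_residual (grad f x) x.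
Proof.
move=> z_min e0; pose k := 1 + 2 * `|z|.
have k0 : 0 < k by rewrite /k; have := normr_ge0 z; lra.
have [r [c [r0 c0 growth]]] := F_class_growth fF z k z_min (ltW k0).
have kr : 0 < k + r by lra.
exists (Num.min c (e / (k + r))); first by rewrite lt_min c0 divr_gt0.
move=> x x0 ex.
have gap := gap_le_kkt_residual fF z x z_min.1 x0; rewrite -/k in gap.
have phi0 := kkt_residual_ge0 (grad f x) x x0.
have krho : 0 < k + `|x - z| by rewrite ltr_pwDl.
rewrite ge_min; have [rx|xr] := leP r `|x - z|.
  rewrite -(ler_pM2r krho).
  by rewrite (le_trans (growth x x0 rx) gap).
apply/orP; right; rewrite ler_pdivrMr//.
apply: le_trans ex (le_trans gap _).
by rewrite ler_wpM2l// lerD2l ltW.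
Qed.

(** * Convergence of sequences with a vanishing drift *)

(** Once [C * a t] is small with respect to [e] and [d], a step from
    [h t >= e / 2] decreases [h] by at least [d / 2 * a t], and a step from
    [h t < e / 2] ends below [e]: the level [e] is never crossed upwards. It is
    reached because the decreases have an infinite sum while [h] is
    nonnegative. *)
Lemma drift_eventually_small {R : realType} (h a phi : nat -> R) (C : R) :
  0 <= C -> (forall t, 0 <= h t) -> (forall t, 0 <= a t) ->
  (forall t, 0 <= phi t) ->
  a t @[t --> \oo] --> 0 ->
  (\sum_(0 <= t < n) a t) @[n --> \oo] --> +oo ->
  (forall t, a t <= 1 -> h t.+1 <= h t - a t * phi t + C * a t ^+ 2) ->
  (forall e, 0 < e -> exists2 d, 0 < d & forall t, e <= h t -> d <= phi t) ->
  forall e, 0 < e -> \forall t \near \oo, h t <= e.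
Proof.
move=> C0 h0 a0 phi0 a_cvg0 a_sum step phi_lb e e0.
have e20 : 0 < e / 2 by lra.
have [d d0 dP] := phi_lb _ e20.
(* C + 1 rather than C, as C may vanish. *)
pose b := Num.min 1 (Num.min (d / 2) (e / 2) / (C + 1)).
have C1 : 0 < C + 1 by lra.
have b0 : 0 < b by rewrite lt_min ltr01 divr_gt0// lt_min; apply/andP; split; lra.
have /cvgrPdist_le/(_ b b0)[T _ aT] := a_cvg0.
have small t : (T <= t)%N -> [/\ a t <= 1, C * a t <= d / 2 & C * a t <= e / 2].
  move=> /aT; rewrite /= sub0r normrN ger0_norm// /b le_min ler_pdivlMr//.
  by rewrite le_min => /and3P[? ? ?]; split => //; have := a0 t; lra.
have decr t : (T <= t)%N -> e / 2 <= h t -> h t.+1 <= h t - d / 2 * a t.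
  move=> /small[a1 Cd _] /dP dphi; apply: le_trans (step t a1) _.
  by have := a0 t; nra.
have stay t : (T <= t)%N -> h t <= e -> h t.+1 <= e.
  move=> Tt ht; have [eh|he] := leP (e / 2) (h t).
    by apply: le_trans (decr t Tt eh) _; have := a0 t; nra.
  have [a1 _ Ce] := small t Tt; apply: le_trans (step t a1) _.
  by have := a0 t; have := phi0 t; nra.
have [t Tt ht] : exists2 t, (T <= t)%N & h t <= e.
  apply: contrapT => never.
  have big t : (T <= t)%N -> e / 2 <= h t.
    move=> Tt; rewrite leNgt; apply/negP => ht; apply: never; exists t => //.
    lra.
  have tele n : h (T + n)%N + d / 2 * \sum_(T <= t < T + n) a t <= h T.
    elim: n => [|n IH]; first by rewrite addn0 big_geq// mulr0 addr0.
    rewrite addnS big_nat_recr ?leq_addr//=.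
    have := decr (T + n)%N (leq_addr _ _) (big _ (leq_addr _ _)); lra.
  pose S := \sum_(0 <= t < T) a t.
  have /cvgryPge/(_ (S + (h T + 1) / (d / 2)))[n0 _ n0P] := a_sum.
  have := n0P (T + n0)%N (leq_addl _ _).
  rewrite /= (big_cat_nat (n := T))//= ?leq_addr// -/S lerD2l ler_pdivrMr; last lra.
  by have := tele n0; have := h0 (T + n0)%N; lra.
exists t => // n /= tn; rewrite -(subnKC tn).
elim: (n - t)%N => [|j IH]; first by rewrite addn0.
by rewrite addnS stay// (leq_trans Tt)// leq_addr.
Qed.

(** * Convergence to the set of minimizers *)

Lemma dist_set_le {R : realType} {N : nat} (x v : 'rV[R]_N)
    (Y : set 'rV[R]_N) : Y v -> 0 <= dist_set x Y <= enorm (v - x).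
Proof.
move=> Yv.
have lb0 : lbound [set enorm (w - x) | w in Y] 0.
  by move=> _ [w _ <-]; exact: enorm_ge0.
apply/andP; split.
  by apply: lb_le_inf => //; exists (enorm (v - x)); exists v.
by apply: ge_inf; [exists 0|exists v].
Qed.

Theorem theorem5 (R : realType) (N : nat) (N_ge1 : (1 <= N)%N)
  (L B : R) (L_gt0 : 0 < L) (B_gt0 : 0 < B)
  (s0 : R) (s0_sign : s0 = 1 \/ s0 = -1)
  (f : 'rV[R]_N -> R) (f_class : F_class L f) (f_bnd : grad_bounded B f)
  (gamma : nat -> R) (gamma_ge0 : forall t, 0 <= gamma t)
  (gamma_cvg0 : gamma t @[t --> \oo] --> (0 : R))
  (gamma_sum : (\sum_(0 <= t < n) gamma t) @[n --> \oo] --> +oo)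
  (x : nat -> 'rV[R]_N) (x0_orthant : orthant (x 0%N))
  (x_step : forall t, x t.+1 = proj_orthant
     (x t - (gamma t / Num.sqrt N%:R) *: signv s0 (grad f (x t)))) :
  dist_set (x t) (orthant_minimizers f) @[t --> \oo] --> (0 : R).
Proof.
have [z z_min] := F_minimizers_nonempty f_class.
have sN : 0 < Num.sqrt (N%:R : R) by rewrite sqrtr_gt0 ltr0n.
pose a t := gamma t / Num.sqrt N%:R.
have a0 t : 0 <= a t by rewrite divr_ge0// ltW.
have a_cvg0 : a t @[t --> \oo] --> (0 : R).
  rewrite -(mul0r (Num.sqrt N%:R)^-1).
  by apply: cvgM gamma_cvg0 _; exact: cvg_cst.
have a_sum : (\sum_(0 <= t < n) a t) @[n --> \oo] --> +oo.
  apply/cvgryPge => A.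
  have /cvgryPge/(_ (A * Num.sqrt N%:R)) := gamma_sum.
  by apply: filterS => n; rewrite -mulr_suml ler_pdivlMr.
have x_orthant t : orthant (x t).
  case: t => [//|t]; rewrite x_step => i; rewrite mxE le_max lexx.
  by rewrite orbT.
have f_to_min e : 0 < e -> \forall t \near \oo, f (x t) - f z <= e.
  apply: (@drift_eventually_small _ _ a
    (fun t => kkt_residual (grad f (x t)) (x t)) (L * N%:R ^+ 2)) => //.
  - by rewrite mulr_ge0 ?exprn_ge0// ltW.
  - by move=> t; rewrite subr_ge0; exact: z_min.2.
  - by move=> t; exact: kkt_residual_ge0.
  - move=> t a1; have a01 : 0 <= a t <= 1 by rewrite a0.
    have := sign_descent f_class s0_sign (x t) _ (a t) (ltW L_gt0)
      (x_orthant t) a01 (x_step t).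
    lra.
  - move=> e' /(kkt_residual_lower_bound f_class z e' z_min)[d d0 dP].
    by exists d => // t; exact: dP.
have [r [c [r0 c0 growth]]] := F_class_growth f_class z 1 z_min ler01.
apply/cvgrPdist_le => e e0.
pose eta := e / N%:R.
have eta0 : 0 < eta by rewrite divr_gt0// ltr0n.
have [|m m0 gap] := @minimizer_gap _ _ _ _ f_class z
    (orthant_minimizers f) r eta z_min.
  rewrite -subset0 => v [[_ _ /(_ v)] /[swap] v_min /(_ v_min)].
  by rewrite subrr normr0 leNgt eta0.
(* Half the minimum, because both gaps must be excluded strictly. *)
have cm0 : 0 < Num.min c m / 2 by rewrite divr_gt0// lt_min c0.
have cm : Num.min c m / 2 < c /\ Num.min c m / 2 < m.
  by rewrite minEle; case: ifPn; rewrite -?ltNge => ?; split; lra.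
apply: filterS (f_to_min _ cm0) => t ht.
have xr : `|x t - z| <= r.
  rewrite leNgt; apply/negP => /ltW rx.
  have := growth (x t) (x_orthant t) rx.
  by have := normr_ge0 (x t - z); case: cm; nra.
have [v v_min xv] : exists2 v, orthant_minimizers f v & `|x t - v| < eta.
  apply: contrapT => far; suff : m <= f (x t) - f z by case: cm; lra.
  apply: gap; split => // v v_min; rewrite leNgt; apply/negP => xv.
  by apply: far; exists v.
have /andP[d0 dv] := dist_set_le (x t) v _ v_min.
rewrite sub0r normrN ger0_norm//; apply: le_trans dv (le_trans (enorm_le_norm _) _).
by rewrite distrC mulrC -ler_pdivlMr ?ltr0n// ltW.
Qed.
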